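(* Let $\Gamma$ be a finite Abelian group with $|\Gamma|\ge 3$. Let $G$ be a graph with at least one pendant vertex such that every non-pendant vertex is in $\Omega_{\mathfrak{s}}(G)$ or in $\Omega_{\mathfrak{n}}(G)$. If there exists a nonzero $g\in\Gamma$ such that $\deg(x)\equiv 1\pmod{o(g)}$ for all $x\in\Omega_{\mathfrak{n}}(G)$, then $G$ is $\Gamma$-vertex magic.
   Context: Graphs are finite, simple and undirected; $o(g)$ is the order of $g$. For an additive Abelian group $\Gamma$ with identity $0$ and a graph $G$, a $\Gamma$-vertex magic labeling is a map $\ell:V(G)\to\Gamma\setminus\{0\}$ for which there is $\mu\in\Gamma$ with $w(v)=\sum_{u\in N(v)}\ell(u)=\mu$ for every vertex $v$; $G$ is $\Gamma$-vertex magic if it has such a labeling. A pendant vertex has degree $1$; a support vertex is one adjacent to a pendant vertex. $\Omega_{\mathfrak{s}}(G)$ is the set of strong support vertices (adjacent to at least two pendant vertices) and $\Omega_{\mathfrak{n}}(G)$ the set of neutral vertices (neither pendant nor support). *)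

(* Defs.v *)
From mathcomp Require Import all_boot all_order all_algebra all_fingroup.

Set Implicit Arguments.
Unset Strict Implicit.
Unset Printing Implicit Defensive.

(* A finite simple graph is a symmetric irreflexive adjacency relation e on a
   finite vertex type V; these two properties are hypotheses of the theorem. *)
Section Graph.

Variables (V : finType) (e : rel V).

Definition neighbors (x : V) : {set V} := [set y | e x y].

Definition deg (x : V) : nat := #|neighbors x|.

Definition pendant : {set V} := [set x | deg x == 1].

Definition support : {set V} := [set x | [exists y in neighbors x, y \in pendant]].

Definition strong_support : {set V} :=
  [set x | 2 <= #|neighbors x :&: pendant|].

Definition neutral : {set V} := [set x | (x \notin pendant) && (x \notin support)].

Local Open Scope ring_scope.

Definition vertex_magic_labeling (A : zmodType) (l : V -> A) : Prop :=
  (forall v, l v != 0) /\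
  exists mu : A, forall v, \sum_(u in neighbors v) l u = mu.

Definition vertex_magic (A : zmodType) : Prop :=
  exists l : V -> A, vertex_magic_labeling l.

End Graph.

(* Main.v *)
Require Import Defs.
From mathcomp Require Import all_boot all_order all_algebra all_fingroup.

(** Give the label g to every non-pendant vertex and aim for the magic constant
    g: a neutral vertex x then has weight deg(x) g = g.  As A has at least three
    elements, every element of A is a sum of k nonzero elements for each k >= 2,
    so the pendant neighbours of a strong support vertex can absorb whatever is
    needed to bring its weight to g. *)

Import GRing.Theory.
Local Open Scope ring_scope.

Lemma exists_notin2 (T : finType) (a b : T) :
  (3 <= #|T|)%N -> exists c : T, c != a /\ c != b.
Proof.
move=> cardT.
have : (0 < #|~: [set a; b]|)%N.
  rewrite cardsCs setCK subn_gt0 cards2.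
  by apply: leq_trans cardT; case: (a != b).
by case/card_gt0P => c; rewrite !inE negb_or => /andP[ca cb]; exists c.
Qed.

(** Fix a nonzero [c] at all points of [S] but two. The remainder [r] is split as [a + (r - a)] over
    those two; both parts are nonzero once [a] avoids [0] and [r], which three elements in [A]
    allow. *)
Lemma exists_nonzero_sum (A : finZmodType) (V : finType) (S : {set V}) (h : A) :
  (3 <= #|A|)%N -> (2 <= #|S|)%N ->
  exists f : V -> A, (forall v, f v != 0) /\ \sum_(v in S) f v = h.
Proof.
move=> cardA /card_gt1P[u [w [uS wS neq_uw]]].
have [c [c0 _]] := exists_notin2 A 0 0 cardA.
pose r := h - c *+ #|S :\ u :\ w|.
have [a [a0 ar]] := exists_notin2 A 0 r cardA.
exists (fun v => if v == u then a else if v == w then r - a else c); split.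
  move=> v; case: ifP => // _; case: ifP => // _.
  by rewrite subr_eq0 eq_sym.
rewrite (big_setD1 u) //= eqxx (big_setD1 w) /=; last by rewrite !inE eq_sym neq_uw.
rewrite eq_sym (negbTE neq_uw) eqxx (eq_bigr (fun=> c)); last first.
  by move=> v; rewrite !inE => /and3P[/negbTE-> /negbTE->].
by rewrite sumr_const addrA addrCA subrr addr0 subrK.
Qed.

Lemma mulrn_order_eq1 (A : finZmodType) (g : A) (n : nat) :
  n = 1%N %[mod #[g]%g] -> g *+ n = g.
Proof.
by move=> n1; rewrite -FinRing.zmodXgE -expg_mod_order n1 expg_mod_order FinRing.zmodXgE mulr1n.
Qed.

Local Close Scope ring_scope.

Theorem theorem2p8 (A : finZmodType) (V : finType) (e : rel V)
  (cardA : 3 <= #|A|)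
  (e_sym : symmetric e) (e_irr : irreflexive e)
  (has_pendant : exists x : V, x \in pendant e)
  (strong_or_neutral : forall x : V, x \notin pendant e ->
     x \in strong_support e \/ x \in neutral e) :
  (exists g : A, g != 0%R /\
     forall x : V, x \in neutral e -> deg e x = 1 %[mod #[g]%g]) ->
  vertex_magic e A.
Proof.
Local Open Scope ring_scope.
case=> g [g0 deg_g].
set N := neighbors e; set P := pendant e.
have pendantN v : v \in P -> exists x, N v = [set x].
  by rewrite inE => /cards1P.
(* The target is what the non-pendant neighbours of [x], each labelled [g], leave missing from
   [g]. *)
have /fin_all_exists[f f_spec] x : exists h : V -> A, (forall v, h v != 0) /\
    ((2 <= #|N x :&: P|)%N ->
     \sum_(v in N x :&: P) h v = g - g *+ #|N x :\: P|).
  have [big_x|_] := boolP (2 <= #|N x :&: P|)%N; last by exists (fun=> g).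
  have [h [h0 hE]] := exists_nonzero_sum _ _ _ (g - g *+ #|N x :\: P|) cardA big_x.
  by exists h.
(* A pendant vertex has a single neighbour, so the choices made at different support vertices never
   conflict. The default [g] serves the components [K_2], whose two ends are both pendant. *)
pose l v := if v \in P then
  (if [pick x | (x \in N v) && (x \notin P)] is Some x then f x v else g) else g.
have l_inner v : v \notin P -> l v = g by rewrite /l => /negbTE->.
have l_pendant v x : v \in P -> x \in N v -> l v = if x \in P then g else f x v.
  move=> vP; have [y Ny] := pendantN v vP; rewrite /l vP Ny inE => /eqP->.
  case: pickP => [z /andP[]|/(_ y)].
    by rewrite inE => /eqP-> /negbTE->.
  by rewrite set11 /= => /negbFE->.
exists l; split.
  move=> v; rewrite /l; case: ifP => // _; case: pickP => // x _.
  exact: (f_spec x).1.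
exists g => v; rewrite -/N.
have [vP|vNP] := boolP (v \in P).
  have [x Nv] := pendantN v vP; rewrite Nv big_set1.
  (* If [x] is pendant too, then [v] and [x] form a [K_2], where [x] has the default label [g]. *)
  have [xP|/l_inner//] := boolP (x \in P).
  have vNx : v \in N x.
    have : x \in N v by rewrite Nv set11.
    by rewrite !inE e_sym.
  by rewrite (l_pendant x v xP vNx) vP.
have [v_strong|v_neutral] := strong_or_neutral v vNP.
  rewrite inE in v_strong.
  rewrite (big_setID P) /= (eq_bigr (f v)); last first.
    move=> u /setIP[uN uP]; rewrite (l_pendant u v uP) ?(negbTE vNP) //.
    by move: uN; rewrite !inE e_sym.
  rewrite (f_spec v).2 // [X in _ + X](eq_bigr (fun=> g)); last first.
    by move=> u /setDP[_ /l_inner].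
  by rewrite sumr_const subrK.
(* A pendant neighbour would make [v] a support vertex, so every label around [v] is [g]. *)
rewrite (eq_bigr (fun=> g)); last first.
  move=> u uN; apply: l_inner; apply/negP => uP.
  move: v_neutral; rewrite !inE => /andP[_ /negP]; apply.
  by apply/existsP; exists u; apply/andP.
by rewrite sumr_const; apply: mulrn_order_eq1; apply: deg_g.
Qed.
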